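(* There exists a class of graphs for which the following holds: for every integer $r \ge 4$, there exists a graph $G$ in the class with $\varphi(G) = \hat{\varphi}(G) = 1$, whereas for every optimal coloring $c$ of $G$, $\varphi_c(G) = r-1$ and $\hat{\varphi}_c(G) = r-2$.
   Context: All graphs are finite, simple and undirected, with at least one vertex. $\chi$ denotes the chromatic number. For a proper vertex coloring $c$ of $G$ and an induced subgraph $H$ of $G$, let $c(H)$ be the set of colors used by $c$ on the vertices of $H$. Define $\varphi_c(G)=\max_{H}\,(|c(H)|-\chi(H))$ over all induced subgraphs $H$ of $G$, and $\hat{\varphi}_c(G)$ as the same maximum taken only over all connected induced subgraphs $H$ of $G$. Define $\varphi(G)=\min_c \varphi_c(G)$ and $\hat{\varphi}(G)=\min_c \hat{\varphi}_c(G)$, the minima over all proper colorings $c$ of $G$ (with any number of colors). An optimal coloring of $G$ is a proper coloring using exactly $\chi(G)$ colors. *)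

(* Defs.v *)
From mathcomp Require Import all_boot.
From mathcomp Require Import boolp.

Set Implicit Arguments.
Unset Strict Implicit.
Unset Printing Implicit Defensive.

(* The empty graph is not excluded by this type: nonemptiness is imposed
   wherever a graph or an induced subgraph is quantified over. *)
Record sgraph := SGraph {
  vertex :> finType;
  adj : rel vertex;
  adj_sym : symmetric adj;
  adj_irr : irreflexive adj }.

Section Induced.
Variables (G : sgraph) (S : {set G}).

Definition induced_adj : rel {x : G | x \in S} := fun u v => adj (val u) (val v).

Lemma induced_adj_sym : symmetric induced_adj.
Proof. by move=> u v; rewrite /induced_adj adj_sym. Qed.

Lemma induced_adj_irr : irreflexive induced_adj.
Proof. by move=> u; rewrite /induced_adj adj_irr. Qed.

Definition induced : sgraph := SGraph induced_adj_sym induced_adj_irr.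
End Induced.

Definition connected (G : sgraph) : bool :=
  (0 < #|G|) && [forall x : G, forall y : G, connect (@adj G) x y].

Definition proper_coloring (G : sgraph) (C : eqType) (c : G -> C) : Prop :=
  forall x y : G, adj x y -> c x != c y.

Definition colorable (G : sgraph) (k : nat) : bool :=
  [exists c : {ffun G -> 'I_k}, forall x, forall y, adj x y ==> (c x != c y)].

Lemma colorable_ex (G : sgraph) : exists k, colorable G k.
Proof.
exists #|G|; apply/existsP; exists [ffun x => enum_rank x].
apply/forallP=> x; apply/forallP=> y; apply/implyP=> xy.
by rewrite !ffunE (inj_eq enum_rank_inj); apply: contraTneq xy => ->; rewrite adj_irr.
Qed.

Definition chi (G : sgraph) : nat := ex_minn (colorable_ex G).

Section Phi.
Variable G : sgraph.
Implicit Types (c : G -> nat) (S : {set G}).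

Definition ncolors c S : nat := size (undup [seq c x | x in S]).

(* Induced subgraphs of G are indexed by their vertex sets. If c is proper then
   chi (induced S) <= ncolors c S, so the subtraction does not truncate; the
   value 0 of an empty maximum is also harmless, single vertices giving 0. *)
Definition phi_col c : nat :=
  \max_(S : {set G} | S != set0) (ncolors c S - chi (induced S)).

Definition phihat_col c : nat :=
  \max_(S : {set G} | connected (induced S)) (ncolors c S - chi (induced S)).

Lemma proper_ex : exists c, proper_coloring c.
Proof.
exists (fun x => enum_rank x : nat) => x y xy.
rewrite val_eqE (inj_eq enum_rank_inj).
by apply: contraTneq xy => ->; rewrite adj_irr.
Qed.

Lemma min_col_ex (f : (G -> nat) -> nat) :
  exists n, `[< exists c, proper_coloring c /\ f c = n >].
Proof. by have [c cP] := proper_ex; exists (f c); apply/asboolP; exists c. Qed.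

Definition phi : nat := ex_minn (min_col_ex phi_col).

Definition phihat : nat := ex_minn (min_col_ex phihat_col).

Definition optimal_coloring c : Prop :=
  proper_coloring c /\ ncolors c [set: G] = chi G.
End Phi.

(* Main.v *)
Require Import Defs.
From mathcomp Require Import all_boot.
From mathcomp Require Import boolp.

(* The witness is a clique u_1, ..., u_r together with an independent set
   v_1, ..., v_r, where v_i is adjacent to u_j exactly when i != j.  With r
   colors, v_i is forced to have the color of u_i, so the independent set of all
   v_i and the star consisting of u_1 and the v_i with i != 1 both receive all r
   colors.  Giving instead one extra color to all the v_i, an induced subgraph
   with k clique vertices has at most k + 1 colors, and chromatic number at
   least k. *)

Set Implicit Arguments.
Unset Strict Implicit.
Unset Printing Implicit Defensive.

(** * Bounds on the chromatic number, and connectivity *)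

Lemma chi_le (G : sgraph) (C : finType) (c : G -> C) :
  proper_coloring c -> chi G <= #|C|.
Proof.
move=> cP; rewrite /chi; case: ex_minnP => m _; apply.
apply/existsP; exists [ffun x => enum_rank (c x)].
apply/forallP=> x; apply/forallP=> y; apply/implyP=> xy.
by rewrite !ffunE (inj_eq enum_rank_inj) cP.
Qed.

Lemma clique_le_chi (G : sgraph) (T : finType) (f : T -> G) :
  (forall x y, x != y -> adj (f x) (f y)) -> #|T| <= chi G.
Proof.
move=> fP; rewrite /chi; case: ex_minnP => m /existsP[c cP] _.
rewrite -[m]card_ord; apply: (@leq_card _ _ (fun x => c (f x))) => x y /eqP cxy.
apply: contraTeq cxy => /fP xy.
by have /forallP/(_ (f y))/implyP/(_ xy) := forallP cP (f x).
Qed.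

Lemma clique_le_chi_induced (G : sgraph) (A S : {set G}) :
  A \subset S -> {in A &, forall x y, x != y -> adj x y} ->
  #|A| <= chi (induced S).
Proof.
move=> sAS clA; rewrite -[#|A|]card_sig.
apply: (@clique_le_chi (induced S) _
  (fun x => Sub (val x) (subsetP sAS _ (valP x)))) => x y xy.
by apply: clA (valP x) (valP y) _; apply: contraNneq xy => /val_inj ->.
Qed.

Lemma connected_from (G : sgraph) (x0 : G) :
  (forall y, connect (@adj G) x0 y) -> connected G.
Proof.
move=> x0P; apply/andP; split; first by apply/card_gt0P; exists x0.
apply/forallP=> x; apply/forallP=> y; apply: connect_trans (x0P y).
by rewrite (sym_connect_sym (@adj_sym G)).
Qed.

Lemma connected_edge (G : sgraph) (x y : G) :
  connected G -> x != y -> exists z, adj x z.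
Proof.
move=> /andP[_ /forallP/(_ x)/forallP/(_ y)/connectP[[|z p] /=]].
  by move=> _ ->; rewrite eqxx.
by move=> /andP[xz _] _ _; exists z.
Qed.

(** * Color counts and bounds valid in every graph *)

Section Colorings.
Variable G : sgraph.
Implicit Types (c : G -> nat) (S : {set G}).

Lemma ncolors_subset c S S' : S \subset S' -> ncolors c S <= ncolors c S'.
Proof.
move=> /subsetP sSS'; apply: uniq_leq_size (undup_uniq _) _ => k.
by rewrite !mem_undup => /imageP[x /sSS' xS ->]; apply: image_f.
Qed.

Lemma ncolors_le_card c S : ncolors c S <= #|S|.
Proof. by rewrite -(size_image c S) size_undup. Qed.

Lemma ncolors_inj c S : {in S &, injective c} -> ncolors c S = #|S|.
Proof.
move=> c_inj; rewrite /ncolors undup_id ?size_image //.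
by rewrite map_inj_in_uniq ?enum_uniq // => x y; rewrite !mem_enum; apply: c_inj.
Qed.

Lemma chi_le_ncolors c : proper_coloring c -> chi G <= ncolors c [set: G].
Proof.
move=> cP; set s := undup [seq c x | x in [set: G]].
have cs x : c x \in s by rewrite mem_undup image_f ?inE.
rewrite /ncolors -/s -(@card_seq_sub _ s) ?undup_uniq //.
by apply: (@chi_le _ _ (fun x => SeqSub (cs x))) => x y /cP.
Qed.

Lemma connected_induced_neq0 S : connected (induced S) -> S != set0.
Proof.
by case/andP=> /card_gt0P[[x xS] _] _; apply/set0Pn; exists x.
Qed.

Lemma phihat_col_le c : phihat_col c <= phi_col c.
Proof.
apply/bigmax_leqP=> S /connected_induced_neq0 S0.
exact: (bigmax_sup S).
Qed.

(** An optimal coloring has only [chi G] colors to show on [S], and one vertex of [S] already forces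
    chromatic number at least 1. *)
Lemma phi_col_optimal_le c : optimal_coloring c -> phi_col c <= chi G - 1.
Proof.
case=> cP cE; apply/bigmax_leqP=> S /set0Pn[x xS].
apply: leq_sub; first by rewrite -cE ncolors_subset ?subsetT.
rewrite -(cards1 x); apply: clique_le_chi_induced; first by rewrite sub1set.
by move=> y z; rewrite !inE => /eqP-> /eqP->; rewrite eqxx.
Qed.

(** A connected [S] with two vertices contains an edge, which raises the lower bound on its
    chromatic number to 2. *)
Lemma phihat_col_optimal_le c : optimal_coloring c -> phihat_col c <= chi G - 2.
Proof.
case=> cP cE; apply/bigmax_leqP=> S conS.
have [x xS] := set0Pn _ (connected_induced_neq0 conS).
have chi_ge (A : {set G}) := @clique_le_chi_induced G A S.
(* A single vertex has no edge, but its difference is 0: [S] is then itself a clique. *)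
have [/card_le1_eqP S1|] := leqP #|S| 1.
  have -> // : ncolors c S - chi (induced S) = 0.
  apply/eqP; rewrite subn_eq0; apply: leq_trans (ncolors_le_card c S) _.
  by apply: chi_ge => // y z yS zS; rewrite (S1 y z) ?eqxx.
case/card_gt1P=> [y [z [yS zS yz]]].
have [|w yw] := @connected_edge (induced S) (Sub y yS) (Sub z zS) conS.
  by rewrite -val_eqE.
have {}yw : adj y (val w) := yw.
apply: leq_sub; first by rewrite -cE ncolors_subset ?subsetT.
have <- : #|[set y; val w]| = 2.
  by rewrite cards2; case: eqVneq yw => // ->; rewrite adj_irr.
apply: chi_ge; first by rewrite subUset !sub1set yS (valP w).
move=> a b; rewrite !inE => /orP[]/eqP-> /orP[]/eqP->; rewrite ?eqxx //.
by rewrite adj_sym.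
Qed.

Lemma phi_le c : proper_coloring c -> phi G <= phi_col c.
Proof.
by move=> cP; rewrite /phi; case: ex_minnP => m _; apply; apply/asboolP; exists c.
Qed.

Lemma phihat_le_phi : phihat G <= phi G.
Proof.
rewrite /phi; case: ex_minnP => m /asboolP[c [cP <-]] _.
apply: leq_trans (phihat_col_le c).
by rewrite /phihat; case: ex_minnP => k _; apply; apply/asboolP; exists c.
Qed.

Lemma chi_induced_setT_le : chi (induced [set: G]) <= chi G.
Proof.
rewrite {2}/chi; case: ex_minnP => m /existsP[c cP] _; rewrite -[m]card_ord.
apply: (@chi_le (induced setT) _ (fun x => c (val x))) => x y xy.
by have /forallP/(_ (val y))/implyP/(_ xy) := forallP cP (val x).
Qed.

(** A proper coloring that is not optimal uses more than [chi G] colors on the whole graph, and the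
    whole graph is among the connected subgraphs; only optimal colorings remain to be assumed. *)
Lemma phihat_gt0 :
  connected (induced [set: G]) ->
  (forall c, optimal_coloring c -> 0 < phihat_col c) -> 0 < phihat G.
Proof.
move=> conG optP; rewrite /phihat; case: ex_minnP => m /asboolP[c [cP <-]] _.
have [/optP //|nopt] := pselect (optimal_coloring c).
apply: (bigmax_sup setT) => //; rewrite subn_gt0.
apply: leq_ltn_trans chi_induced_setT_le _.
rewrite ltn_neqAle chi_le_ncolors // andbT.
by apply/eqP=> cE; apply: nopt; split.
Qed.

End Colorings.

(** * The witness graph and its colorings *)

Section Crown.
Variable r : nat.

(* [(i, true)] is the clique vertex u_i and [(i, false)] is v_i. *)
Definition crown_adj : rel ('I_r * bool) :=
  fun x y => (x.1 != y.1) && (x.2 || y.2).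

Lemma crown_adj_sym : symmetric crown_adj.
Proof. by move=> x y; rewrite /crown_adj eq_sym orbC. Qed.

Lemma crown_adj_irr : irreflexive crown_adj.
Proof. by move=> x; rewrite /crown_adj eqxx. Qed.

Definition crown : sgraph := SGraph crown_adj_sym crown_adj_irr.

Lemma chi_crown : chi crown = r.
Proof.
apply/eqP; rewrite eqn_leq; apply/andP; split.
  rewrite -[leqRHS]card_ord.
  by apply: (@chi_le crown _ fst) => x y /andP[].
rewrite -[leqLHS]card_ord.
by apply: (@clique_le_chi crown _ (fun i => (i, true))) => i j ij; apply/andP.
Qed.

Lemma phi_crown_le1 : phi crown <= 1.
Proof.
(* Color 0 is the extra color shared by all v_i; the successor keeps the clique colors away from
   it. *)
pose c (x : crown) : nat := if x.2 then x.1.+1 else 0.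
have cP : proper_coloring c.
  by move=> [i []] [j []] /andP[/= ij]; rewrite /c //= eqSS.
apply: leq_trans (phi_le cP) _; apply/bigmax_leqP=> S _.
pose A := [set x in S | x.2].
rewrite leq_subLR addnC; apply: (@leq_trans (#|A|.+1)).
  rewrite -(size_image c A).
  apply: (@uniq_leq_size _ _ (0 :: image c A) (undup_uniq _)) => k.
  rewrite mem_undup inE => /imageP[x xS ->].
  case x2: x.2; last by rewrite /c x2.
  by rewrite image_f ?orbT // inE xS.
rewrite add1n ltnS; apply: clique_le_chi_induced.
  by apply/subsetP=> x; rewrite inE => /andP[].
move=> [i a] [j b]; rewrite !inE /= => /andP[_ ->] /andP[_ ->].
by rewrite /crown_adj /= andbT; apply: contraNneq => ->.
Qed.

(** The clique uses up all r colors, so a vertex of index i has the color of some u_j; j = i,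
    because the vertex is adjacent to every other u_j. *)
Lemma crown_optimalE (c : crown -> nat) :
  optimal_coloring c -> forall x y, (c x == c y) = (x.1 == y.1).
Proof.
case=> cP; rewrite chi_crown => cE.
have u_inj : injective (fun i : 'I_r => c (i, true)).
  move=> i j /eqP; apply: contraTeq => ij.
  by apply: (cP (i, true) (j, true)); apply/andP.
have cu x : c x = c (x.1, true).
  case: x => i a /=.
  have : c (i, a) \in [seq c (j, true) | j : 'I_r].
    have u_uniq : uniq [seq c (j, true) | j : 'I_r].
      by rewrite map_inj_uniq ?enum_uniq.
    (* The r distinct clique colors lie in the list of all r colors, so the two lists have the same
       members. *)
    have [||_ ->] := @uniq_min_size _ _
        (undup [seq c x | x in [set: crown]]) u_uniq.
    - by move=> k /imageP[j _ ->]; rewrite mem_undup image_f ?inE.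
    - by rewrite size_image card_ord -/(ncolors c setT) cE.
    by rewrite mem_undup image_f ?inE.
  case/imageP=> j _ cij; have [jE|ij] := eqVneq j i; first by rewrite cij jE.
  suff /cP : adj ((i, a) : crown) (j, true) by rewrite cij eqxx.
  by apply/andP; rewrite /= eq_sym ij orbT.
by move=> x y; rewrite (cu x) (cu y) (inj_eq u_inj).
Qed.

(** A choice of u_i or v_i for each i. Both extremal subgraphs have this form: [xpred0] gives the
    independent set, [pred1 i0] the star centered at u of index [i0]. *)
Definition section_set (g : 'I_r -> bool) : {set crown} :=
  [set (i, g i) | i : 'I_r].

Lemma ncolors_section_set (c : crown -> nat) g :
  optimal_coloring c -> ncolors c (section_set g) = r.
Proof.
move=> cO; rewrite ncolors_inj.
  by rewrite card_imset ?card_ord // => i j [].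
move=> _ _ /imsetP[i _ ->] /imsetP[j _ ->] /eqP.
by rewrite crown_optimalE // => /eqP /= ->.
Qed.

Lemma phi_col_crown (c : crown -> nat) :
  0 < r -> optimal_coloring c -> phi_col c = r - 1.
Proof.
move=> r0 cO; apply/eqP; rewrite eqn_leq -{1}chi_crown phi_col_optimal_le //=.
apply: (bigmax_sup (section_set xpred0)).
  by apply/set0Pn; exists (Ordinal r0, false); apply/imsetP; exists (Ordinal r0).
rewrite ncolors_section_set // leq_sub2l // -card_unit.
(* One color suffices, as no two v_i are adjacent. *)
apply: (@chi_le (induced _) _ (fun=> tt)) => [[x xS] [y yS]].
case/imsetP: (xS) => i _ xE; case/imsetP: (yS) => j _ yE.
by rewrite /= /induced_adj /= xE yE /crown_adj /= andbF.
Qed.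

Lemma phihat_col_crown (c : crown -> nat) :
  0 < r -> optimal_coloring c -> phihat_col c = r - 2.
Proof.
move=> r0 cO; apply/eqP; rewrite eqn_leq -{1}chi_crown phihat_col_optimal_le //=.
pose i0 := Ordinal r0; pose S := section_set (pred1 i0).
have SE (x : crown) : (x \in S) = (x.2 == (x.1 == i0)).
  apply/imsetP/eqP=> [[i _ -> //]|xE].
  by exists x.1 => //; rewrite /= -xE; case: (x).
apply: (bigmax_sup S).
  have ctrS : (i0, true) \in S by rewrite SE /= eqxx.
  apply: (@connected_from (induced S) (Sub (i0, true) ctrS)).
  move=> [[i a] xS]; have := xS; rewrite SE /= => /eqP aE.
  have [iE|ii0] := eqVneq i i0.
    rewrite (_ : Sub _ _ = exist _ (i, a) xS) ?connect0 //.
    by apply: val_inj; rewrite /= aE iE eqxx.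
  by apply: connect1; rewrite /= /induced_adj /= /crown_adj /= eq_sym ii0.
rewrite ncolors_section_set // leq_sub2l // -card_bool.
(* The second component is the 2-coloring of the star that separates center from leaves. *)
apply: (@chi_le (induced S) _ (fun x => (val x).2)) => [[[i a] xS] [[j b] yS]].
rewrite /= /induced_adj /= /crown_adj /=; move: xS yS.
rewrite !SE /= => /eqP-> /eqP->.
by case: (i =P i0) => [->|_]; case: (j =P i0) => [->|_]; rewrite ?eqxx ?andbF.
Qed.

Lemma connected_crown : 1 < r -> connected (induced [set: crown]).
Proof.
move=> r1; pose i0 := Ordinal (ltnW r1); pose i1 := Ordinal r1.
pose u i : induced [set: crown] := Sub (i, true) (in_setT _).
apply: (@connected_from _ (u i0)) => - [[i a] xS].
have [iE|ii0] := eqVneq i i0.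
  (* The vertex [(i0, false)] is not adjacent to [u i0], hence the detour through [u i1]. *)
  apply: (@connect_trans _ _ (u i1)); apply: connect1 => //.
  by rewrite /= /induced_adj /= iE.
by apply: connect1; rewrite /= /induced_adj /= /crown_adj /= eq_sym ii0.
Qed.

End Crown.

Theorem theorem7p1 :
  exists K : sgraph -> Prop,
    (forall G : sgraph, K G -> 0 < #|G|) /\
    forall r : nat, 4 <= r ->
      exists G : sgraph,
        [/\ K G, phi G = 1, phihat G = 1 &
            forall c : G -> nat, optimal_coloring c ->
              phi_col c = r - 1 /\ phihat_col c = r - 2].
Proof.
exists (fun G : sgraph => 0 < #|G| : Prop); split=> // r r4; exists (crown r).
have r0 : 0 < r by apply: leq_trans r4.
(* Both values are squeezed in 0 < [phihat] <= [phi] <= 1; on optimal colorings the positivity is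
   that of r - 2. *)
have hat_gt0 : 0 < phihat (crown r).
  apply: phihat_gt0 => [|c cO]; first by apply: connected_crown; apply: leq_trans r4.
  by rewrite phihat_col_crown // subn_gt0; apply: leq_trans r4.
have phi_le1 := phi_crown_le1 r; have hat_phi := phihat_le_phi (crown r).
split.
- by apply/card_gt0P; exists (Ordinal r0, true).
- by apply/eqP; rewrite eqn_leq phi_le1 (leq_trans hat_gt0).
- by apply/eqP; rewrite eqn_leq hat_gt0 (leq_trans hat_phi).
by move=> c cO; rewrite phi_col_crown // phihat_col_crown.
Qed.
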